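(* Let $G=(V,E)$ be a finite simple graph with $n=|V|>6$, and let $\mathcal{C}$ be a set of $k$ cycles of $G$, of lengths $n_1,n_2,\dots,n_k$, which induces a generalized $(n_1,\dots,n_k)$-puzzle on $V$. Then the configuration group of $\mathcal{C}$ (the subgroup of the symmetric group on $V$ generated by the cyclic permutations associated with the cycles in $\mathcal{C}$) is the alternating group $A_n$ if $n_1,\dots,n_k$ are all odd, and it is the symmetric group $S_n$ otherwise. Moreover, any permutation in the configuration group can be generated in $O(n^5)$ shifts, i.e. is a product of at most $Kn^5$ factors (for an absolute constant $K$), each being the permutation associated with a cycle in $\mathcal{C}$ or its inverse.
   Context: To a cycle $C=(v_1,\dots,v_j)$ of $G$ one associates the cyclic permutation $(v_1\ v_2\ \dots\ v_j)$ of $V$; shifting tokens along $C$ means applying this permutation or its inverse. Two cycles are properly interconnected if they share exactly one vertex, or share exactly two vertices which are consecutive in both cycles. The interconnection graph $\hat G$ has vertex set $\mathcal{C}$ and an edge between two cycles iff they are properly interconnected. $\mathcal{C}$ induces a generalized $(n_1,\dots,n_k)$-puzzle on $V$ (with $|V|>6$) if there is a subset $\mathcal{C}'\subseteq\mathcal{C}$ such that (1) $\mathcal{C}'$ contains at least two cycles, (2) the induced subgraph $\hat G[\mathcal{C}']$ is connected, and (3) every vertex of $G$ lies on at least one cycle of $\mathcal{C}'$. *)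

(* Defs.v *)
From mathcomp Require Import all_boot all_fingroup all_solvable.
From mathcomp Require Import alt.
Set Implicit Arguments. Unset Strict Implicit. Unset Printing Implicit Defensive.

Section Puzzle.
Variable T : finType.

Definition simple_graph (e : rel T) : Prop := symmetric e /\ irreflexive e.

Definition is_cycle (e : rel T) (c : seq T) : Prop :=
  [/\ 3 <= size c, uniq c & forall x, x \in c -> e x (next c x)].

(* The cyclic permutation (v_1 v_2 ... v_j) associated to a cycle:
   v_i |-> v_{i+1}, v_j |-> v_1, identity off the cycle. *)
Definition cycle_perm (c : seq T) : {perm T} :=
  match uniq c =P true with
  | ReflectT U => perm (can_inj (prev_next U))
  | ReflectF _ => 1%g
  end.

Definition consecutive (c : seq T) (u v : T) : bool :=
  [&& u \in c, v \in c & (next c u == v) || (next c v == u)].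

Definition properly_interconnected (c d : seq T) : bool :=
  let S := [set x | (x \in c) && (x \in d)] in
  (#|S| == 1) ||
  ((#|S| == 2) && [forall u in S, forall v in S,
                    (u != v) ==> (consecutive c u v && consecutive d u v)]).

Definition interconnection_connected (C' : seq (seq T)) : Prop :=
  forall c d, c \in C' -> d \in C' ->
    exists p : seq (seq T),
      [/\ all (mem C') p, path properly_interconnected c p & last c p = d].

Definition induces_generalized_puzzle (C : seq (seq T)) : Prop :=
  exists C' : seq (seq T),
    [/\ {subset C' <= C},
        2 <= size (undup C'),
        interconnection_connected C'
      & forall v : T, exists2 c, c \in C' & v \in c].

Definition config_group (C : seq (seq T)) : {set {perm T}} :=
  <<[set:: map cycle_perm C]>>%g.

Definition shift (p : seq T * bool) : {perm T} :=
  if p.2 then cycle_perm p.1 else (cycle_perm p.1)^-1%g.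

End Puzzle.

(* Main.v *)
Require Import Defs.
From mathcomp Require Import all_boot all_fingroup all_solvable.
From mathcomp Require Import alt.
From mathcomp Require Import zify.

(* A commutator of two cyclic permutations sharing exactly one vertex is a 3-cycle;
   if they share exactly one edge it is a double transposition, and two double
   transpositions whose supports meet in one point again have a 3-cycle as
   commutator.  Suitable conjugates with this property exist as soon as one of the
   two cycles has length at least 5, or, when all cycles have length 4, from three
   cycles covering more than 6 vertices; so a 3-cycle is always reached in boundedly
   many shifts.  A maximal set [S] all of whose 3-cycles lie in the group is a block;
   having at least 3 points it leaves the intersection of two interconnected
   cycles, hence swallows both, and by connectivity it is everything: the group
   contains the alternating group.  For the length, any 3-cycle is conjugate to
   the first one by a word of length at most n^3 (a shortest path in the Schreier
   graph on triples), and an even permutation is a product of at most n 3-cycles,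
   which even gives O(n^4). *)

Set Implicit Arguments. Unset Strict Implicit. Unset Printing Implicit Defensive.

(** * Supports of permutations, 3-cycles and commutators *)

Section MovedPoints.
Local Open Scope group_scope.
Variable T : finType.
Implicit Types (g h s t : {perm T}) (x y z p q : T).

Definition moved g : {set T} := [set x | g x != x].

Lemma movedN g x : x \notin moved g -> g x = x.
Proof. by rewrite inE negbK => /eqP. Qed.

Lemma movedV g : moved g^-1 = moved g.
Proof. by apply/setP=> x; rewrite !inE -(inj_eq (@perm_inj _ g)) permKV eq_sym. Qed.

Lemma moved_perm g x : (g x \in moved g) = (x \in moved g).
Proof. by rewrite !inE (inj_eq (@perm_inj _ g)). Qed.

Lemma movedJ g h x : (h x \in moved (g ^ h)) = (x \in moved g).
Proof. by rewrite !inE permJ (inj_eq (@perm_inj _ h)). Qed.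

Lemma moved_stable g x : x \in moved g -> g x \in moved g.
Proof. by rewrite moved_perm. Qed.

Lemma moved_stableV g x : x \in moved g -> g^-1 x \in moved g.
Proof. by rewrite -movedV moved_perm. Qed.

(** Products of permutations are read from left to right, so this sends x to y, y to z and z to x.
    Written with [tperm], it inverts and conjugates by rewriting alone. *)
Definition cyc3 x y z : {perm T} := tperm x y * tperm x z.

Lemma cyc3E x y z w : uniq [:: x; y; z] ->
  cyc3 x y z w =
  if w == x then y else if w == y then z else if w == z then x else w.
Proof.
rewrite /= !inE negb_or andbT => /andP[/andP[xy xz] yz].
rewrite permM; case: (tpermP x y w) => [->|->|].
- by rewrite eqxx tpermD // eq_sym.
- by rewrite eqxx eq_sym (negPf xy) tpermL.
move=> /eqP wx /eqP wy; rewrite (negPf wx) (negPf wy).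
case: (w =P z) => [->|/eqP wz]; first by rewrite tpermR.
by rewrite tpermD // eq_sym.
Qed.

Lemma cyc3V x y z : (cyc3 x y z)^-1 = cyc3 x z y.
Proof. by rewrite /cyc3 invMg !tpermV. Qed.

Lemma cyc3_rot x y z : uniq [:: x; y; z] -> cyc3 x y z = cyc3 y z x.
Proof.
move=> U; have U' : uniq [:: y; z; x] by rewrite -(rot_uniq 1) in U.
apply/permP=> w; rewrite !cyc3E //; move: U.
rewrite /= !inE negb_or andbT => /andP[/andP[xy xz] yz].
case: (w =P x) => [->|_]; first by rewrite (negPf xy) (negPf xz).
by case: (w == y).
Qed.

Lemma cyc3J x y z g : cyc3 x y z ^ g = cyc3 (g x) (g y) (g z).
Proof. by rewrite /cyc3 conjMg !tpermJ. Qed.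

Lemma odd_cyc3 x y z : uniq [:: x; y; z] -> odd_perm (cyc3 x y z) = false.
Proof.
rewrite /= !inE negb_or andbT => /andP[/andP[xy xz] yz].
by rewrite odd_permM !odd_tperm xy xz.
Qed.

(** The leftmost factor of [g^-1 * h^-1 * g * h] acts first, hence the reversed order of
    application. *)
Lemma commgE g h x : [~ g, h] x = h (g (h^-1 (g^-1 x))).
Proof. by rewrite commgEl /conjg !permM. Qed.

(** Away from [p], a point moved by one permutation is fixed by the other, so on most points each
    letter cancels against its inverse. Only [p], [h p] and [g p] have a trajectory that passes
    through [p] and escapes this cancellation. *)
Lemma commg_cyc3 g h p :
    (forall x, (x \in moved g) && (x \in moved h) = (x == p)) ->
  uniq [:: p; h p; g p] /\ [~ g, h] = cyc3 p (h p) (g p).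
Proof.
move=> gh; have /andP[pg ph] : (p \in moved g) && (p \in moved h) by rewrite gh.
have only_p x : x \in moved g -> x != p -> h x = x /\ h^-1 x = x.
  move=> xg xp; have xh: x \notin moved h.
    by apply: contra xp => xh; rewrite -gh xg.
  by split; apply: movedN; rewrite ?movedV.
have only_p' x : x \in moved h -> x != p -> g x = x /\ g^-1 x = x.
  move=> xh xp; have xg: x \notin moved g.
    by apply: contra xp => xg; rewrite -gh xg.
  by split; apply: movedN; rewrite ?movedV.
have gp: g p != p by move: pg; rewrite inE.
have hp: h p != p by move: ph; rewrite inE.
have gVp: g^-1 p != p by move: pg; rewrite -movedV inE.
have hVp: h^-1 p != p by move: ph; rewrite -movedV inE.
have hgp : h p != g p.
  apply: contra hp => /eqP E; rewrite -gh moved_perm ph andbT E.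
  by rewrite moved_perm.
have U : uniq [:: p; h p; g p].
  by rewrite /= !inE negb_or ![p == _]eq_sym hp gp hgp.
split=> //; apply/permP=> x; rewrite cyc3E // commgE.
case: (x =P p) => [->|/eqP xp].
  by have [_ ->] := only_p _ (moved_stableV pg) gVp; rewrite permKV.
case: (x =P h p) => [->|/eqP xhp].
  have [_ ->] := only_p' _ (moved_stable ph) hp; rewrite permK.
  by have [-> _] := only_p _ (moved_stable pg) gp.
case: (x =P g p) => [->|/eqP xgp].
  rewrite permK; have [-> _] := only_p' _ (moved_stableV ph) hVp.
  by rewrite permKV.
have [xg|xg] := boolP (x \in moved g).
  have gx : g^-1 x != p by rewrite -(inj_eq (@perm_inj _ g)) permKV.
  have [_ ->] := only_p _ (moved_stableV xg) gx; rewrite permKV.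
  by have [-> _] := only_p _ xg xp.
rewrite (_ : g^-1 x = x); last by apply: movedN; rewrite movedV.
have [xh|xh] := boolP (x \in moved h).
  have hx : h^-1 x != p by rewrite -(inj_eq (@perm_inj _ h)) permKV.
  by have [-> _] := only_p' _ (moved_stableV xh) hx; rewrite permKV.
by rewrite (_ : h^-1 x = x) ?movedN ?movedV //; apply: movedN; rewrite movedV.
Qed.

(* The commutator is the double transposition [(p q) (g q  h q)]. *)
Lemma moved_commg g h p q :
    (forall x, (x \in moved g) && (x \in moved h) = (x \in [set p; q])) ->
    g p = q -> h p = q -> g q != p -> h q != p ->
  moved [~ g, h] =i [:: p; q; g q; h q].
Proof.
move=> gh gp hp gq hq.
have /andP[pg ph] : (p \in moved g) && (p \in moved h) by rewrite gh !inE eqxx.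
have /andP[qg qh] : (q \in moved g) && (q \in moved h).
  by rewrite gh !inE eqxx orbT.
have pq : q != p by rewrite -gp; move: pg; rewrite inE.
have gqq : g q != q by move: qg; rewrite inE.
have hqq : h q != q by move: qh; rewrite inE.
have only_pq x : x \in moved g -> x != p -> x != q -> h x = x /\ h^-1 x = x.
  move=> xg xp xq; have xh: x \notin moved h.
    by apply/negP=> xh; have := gh x; rewrite xg xh !inE (negPf xp) (negPf xq).
  by split; apply: movedN; rewrite ?movedV.
have only_pq' x : x \in moved h -> x != p -> x != q -> g x = x /\ g^-1 x = x.
  move=> xh xp xq; have xg: x \notin moved g.
    by apply/negP=> xg; have := gh x; rewrite xg xh !inE (negPf xp) (negPf xq).
  by split; apply: movedN; rewrite ?movedV.
have ghq : h q != g q.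
  apply/negP=> /eqP E; have := gh (h q).
  by rewrite moved_perm qh {1}E moved_perm qg !inE (negPf hq) (negPf hqq).
have gVq : g^-1 q = p by rewrite -gp permK.
have hVq : h^-1 q = p by rewrite -hp permK.
have gVp : g^-1 p != q by apply: contra gq => /eqP<-; rewrite permKV.
have gVpp : g^-1 p != p by move: pg; rewrite -movedV inE.
have hVp : h^-1 p != q by apply: contra hq => /eqP<-; rewrite permKV.
have hVpp : h^-1 p != p by move: ph; rewrite -movedV inE.
move=> x; rewrite !inE commgE.
case: (x =P p) => [->|/eqP xp].
  have [_ ->] := only_pq _ (moved_stableV pg) gVpp gVp.
  by rewrite permKV hp.
case: (x =P q) => [->|/eqP xq].
  rewrite gVq; have [-> _] := only_pq' _ (moved_stableV ph) hVpp hVp.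
  by rewrite permKV eq_sym.
case: (x =P g q) => [->|/eqP xgq].
  by rewrite permK hVq gp.
case: (x =P h q) => [->|/eqP xhq].
  have [_ ->] := only_pq' _ (moved_stable qh) hq hqq; rewrite permK.
  have [-> _] := only_pq _ (moved_stable qg) gq gqq.
  by rewrite eq_sym.
apply/negbTE; rewrite negbK; apply/eqP.
have [xg|xg] := boolP (x \in moved g).
  have gx : g^-1 x != p by rewrite -(inj_eq (@perm_inj _ g)) permKV gp.
  have gx' : g^-1 x != q by rewrite -(inj_eq (@perm_inj _ g)) permKV.
  have [_ ->] := only_pq _ (moved_stableV xg) gx gx'; rewrite permKV.
  by have [-> _] := only_pq _ xg xp xq.
rewrite (_ : g^-1 x = x); last by apply: movedN; rewrite movedV.
have [xh|xh] := boolP (x \in moved h).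
  have hx : h^-1 x != p by rewrite -(inj_eq (@perm_inj _ h)) permKV hp.
  have hx' : h^-1 x != q by rewrite -(inj_eq (@perm_inj _ h)) permKV.
  by have [-> _] := only_pq' _ (moved_stableV xh) hx hx'; rewrite permKV.
by rewrite (_ : h^-1 x = x) ?movedN ?movedV //; apply: movedN; rewrite movedV.
Qed.

(** If nothing besides [x] and [g x] were moved, [g] would be a transposition, which is odd. *)
Lemma even_perm_moved g x : g \in 'Alt_T -> g x != x ->
  exists2 z, g z != z & uniq [:: x; g x; z].
Proof.
rewrite Alt_even => ge gx.
have [/existsP[z /and3P[gz zx zy]]|] :=
    boolP [exists z, [&& g z != z, z != x & z != g x]].
  by exists z; rewrite //= !inE negb_or eq_sym gx ![_ == z]eq_sym zx zy.
rewrite negb_exists => /forallP no_z.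
suff g_tp : g = tperm x (g x) by move: ge; rewrite g_tp odd_tperm eq_sym gx.
have fixed z : z != x -> z != g x -> g z = z.
  by move=> zx zy; have:= no_z z; rewrite zx zy !andbT negbK => /eqP.
apply/permP=> z; case: tpermP => [->//|->|/eqP zx /eqP zy]; last exact: fixed.
have [//|ggx] := eqVneq (g (g x)) x.
have /perm_inj E : g (g (g x)) = g (g x).
  by apply: fixed; rewrite // (inj_eq (@perm_inj _ g)).
by have /perm_inj/eqP := E; rewrite (negPf gx).
Qed.

End MovedPoints.

(** * Permutations with one nontrivial orbit, and 3-cycles obtained from a shared edge *)

Section Rotations.
Local Open Scope group_scope.
Variable T : finType.
Implicit Types (g h k : {perm T}) (x y z p q u : T) (S : {set T}) (c : seq T).

(** This form does not fix a starting point or a direction, so it is stable under inversion and both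
    shifts along a cycle are treated alike. *)
Definition rotation g S : Prop :=
  moved g = S /\ (forall x, x \in S -> porbit g x = S).

Lemma rotationV g S : rotation g S -> rotation g^-1 S.
Proof. by case=> gS orbS; split=> [|x /orbS]; rewrite ?movedV ?porbitV. Qed.

Lemma rotation_traject g S x : rotation g S -> x \in S ->
  uniq (traject g x #|S|) /\ S =i traject g x #|S|.
Proof.
case=> _ orbS /orbS xS; split.
  by have:= uniq_traject_porbit g x; rewrite xS.
by move=> y; have:= porbit_traject g x y; rewrite xS.
Qed.

Lemma rotation_uniq g S x m : rotation g S -> x \in S -> m <= #|S| ->
  uniq (traject g x m).
Proof.
move=> gS xS mS; have [U _] := rotation_traject gS xS.
rewrite (_ : traject g x m = take m (traject g x #|S|)) ?take_uniq //.
by rewrite -(subnKC mS) trajectD take_size_cat // size_traject.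
Qed.

Lemma rotation_pow g S x y : rotation g S -> x \in S -> y \in S ->
  exists2 i, i < #|S| & y = (g ^+ i) x.
Proof.
move=> gS xS; have [_ ->] := rotation_traject gS xS.
by case/trajectP=> i iS ->; exists i; rewrite ?permX.
Qed.

Lemma rotation_cyc3 g S : rotation g S -> #|S| = 3 ->
  exists x y z, uniq [:: x; y; z] /\ g = cyc3 x y z.
Proof.
move=> gS S3; have [x xS] : exists x, x \in S by apply/card_gt0P; rewrite S3.
have [U ES] := rotation_traject gS xS; rewrite S3 /= in U ES.
exists x, (g x), (g (g x)); split=> //.
have ggg : g (g (g x)) = x.
  have: g (g (g x)) \in S by rewrite -gS.1 !moved_perm gS.1.
  move: U; rewrite ES /= !inE !(inj_eq (@perm_inj _ g)) negb_or andbT.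
  case/andP=> /andP[xg xgg] _ /or3P[/eqP//||].
    by rewrite eq_sym (negPf xgg).
  by rewrite eq_sym (negPf xg).
apply/permP=> y; rewrite cyc3E //.
case: eqP => [->//|/eqP yx]; case: eqP => [->//|/eqP ygx].
case: eqP => [->//|/eqP yggx]; apply: movedN.
by rewrite gS.1 ES !inE !negb_or yx ygx yggx.
Qed.

Section SharedEdge.

Variables (g h : {perm T}) (S S' : {set T}) (p q : T).
Hypotheses (gS : rotation g S) (hS : rotation h S').
Hypotheses (SS' : S :&: S' = [set p; q]) (gp : g p = q) (hp : h p = q).

Let common x : (x \in moved g) && (x \in moved h) = (x \in [set p; q]).
Proof. by rewrite gS.1 hS.1 -in_setI SS'. Qed.

Let pS : p \in S.
Proof. by have: p \in S :&: S'; [rewrite SS' !inE eqxx | case/setIP]. Qed.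
Let pS' : p \in S'.
Proof. by have: p \in S :&: S'; [rewrite SS' !inE eqxx | case/setIP]. Qed.

(** The lengths ensure that neither rotation returns from [q] to [p], which is what [moved_commg]
    asks for. *)
Lemma moved_edge_commg : 2 < #|S| -> 2 < #|S'| ->
  moved [~ g, h] =i [:: p; q; g q; h q].
Proof.
move=> S3 S'3; apply: moved_commg => //.
  have:= rotation_uniq gS pS S3; rewrite /= gp !inE negb_or eq_sym.
  by case/andP=> /andP[_ ]; rewrite eq_sym.
have:= rotation_uniq hS pS' S'3; rewrite /= hp !inE negb_or.
by case/andP=> /andP[_ ]; rewrite eq_sym.
Qed.

End SharedEdge.

(** The inverses share the edge from q to p, so the second commutator moves q, p, [g^-1 p] and
    [h^-1 p]. Conjugating by [g^-1] pushes the points of S among these one step back along S and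
    fixes [h^-1 p]. As S has at least five points, the result meets the support of [[~ g, h]] in p
    alone, and [commg_cyc3] applies. *)
Lemma edge_long_cyc3 g h S S' p q :
    rotation g S -> rotation h S' -> S :&: S' = [set p; q] ->
    g p = q -> h p = q -> 4 < #|S| -> 3 < #|S'| ->
  exists x y z, uniq [:: x; y; z] /\
    [~ [~ g, h], [~ g^-1, h^-1] ^ g^-1] = cyc3 x y z.
Proof.
move=> gS hS SS' gp hp S5 S'4.
have /setIP[pS pS'] : p \in S :&: S' by rewrite SS' !inE eqxx.
have gVq : g^-1 q = p by rewrite -gp permK.
have hVq : h^-1 q = p by rewrite -hp permK.
have common x : x \in S -> x \in S' -> (x == p) || (x == q).
  by move=> xS xS'; have := in_setI x S S'; rewrite xS xS' SS' !inE.
have Mt := moved_edge_commg gS hS SS' gp hp (ltnW (ltnW S5)) (ltnW S'4).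
have Mt' : moved [~ g^-1, h^-1] =i [:: q; p; g^-1 p; h^-1 p].
  apply: moved_edge_commg (rotationV gS) (rotationV hS) _ _ _ _ _ => //.
  - by rewrite SS' setUC.
  - exact: ltnW (ltnW _).
  - exact: ltnW _.
have Mt'' x : (x \in moved ([~ g^-1, h^-1] ^ g^-1)) = (g x \in moved [~ g^-1, h^-1]).
  by rewrite -{1}(permK g x) movedJ.
set z := g^-1 p in Mt'; set y := h^-1 p in Mt'.
have zS : z \in S by rewrite /z -gS.1 moved_stableV // gS.1.
have yS' : y \in S' by rewrite /y -hS.1 moved_stableV // hS.1.
have gz : g z = p by rewrite permKV.
have hy : h y = p by rewrite permKV.
have z'S : g^-1 z \in S by rewrite -gS.1 moved_stableV // gS.1.
have := rotation_uniq gS z'S S5; rewrite /= !permKV gp /=.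
have := rotation_uniq hS yS' S'4; rewrite /= hy hp /=.
have gqS : g q \in S by rewrite -gp -gS.1 !moved_perm gS.1.
have hqS : h q \in S' by rewrite -hp -hS.1 !moved_perm hS.1.
set z' := g^-1 z => U1 U2.
have gz' : g z' = z by rewrite permKV.
have ggqS : g (g q) \in S by rewrite -gS.1 moved_perm gS.1.
move: U1 U2; rewrite !inE !negb_or !andbT.
case/and3P=> /and3P[yp yq yhq] /andP[pq phq] qhq.
case/and4P=> /and4P[z'z z'p z'q z'gq] /and3P[zp zq zgq] /andP[_ pgq] qgq.
have yS : y \notin S.
  by apply/negP=> /common/(_ yS'); rewrite (negPf yp) (negPf yq).
have hqNS : h q \notin S.
  by apply/negP=> /common/(_ hqS); rewrite ![h q == _]eq_sym (negPf phq) (negPf qhq).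
have neqS a b : a \in S -> b \notin S -> a != b by move=> aS; apply: contra => /eqP<-.
exists p; eexists; eexists; apply: commg_cyc3 => x.
rewrite Mt Mt'' Mt' !inE; apply/andP/eqP=> [[]|->]; last first.
  by rewrite gp !eqxx.
case/or4P=> /eqP->.
- by [].
- rewrite ![g q == _]eq_sym (negPf qgq) (negPf pgq) (negPf zgq) /= eq_sym.
  by rewrite (negPf (neqS _ _ _ _)).
- rewrite [_ == y](negPf (neqS _ _ _ _)) // orbF.
  have gE a b b' : g b = b' -> (g a == b') = (a == b) by move<-; apply: inj_eq perm_inj _ _.
  rewrite (gE (g q) _ _ gp) (gE (g q) _ _ gz) (gE (g q) _ _ gz').
  by rewrite ![g q == _]eq_sym (negPf pgq) (negPf zgq) (negPf z'gq).
rewrite (movedN (_ : h q \notin moved g)) ?gS.1 //.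
by rewrite ![h q == _]eq_sym (negPf qhq) (negPf phq) (negPf yhq) (negPf (neqS _ _ _ _)).
Qed.

(* Two 4-cycles sharing an edge only generate PGL_2(5) on their six vertices, so
   the third cycle must bring in a new vertex [k q'].  In PGL_2(5) there is a
   double transposition fixing the shared pair [p', q']. *)
Lemma edge_four_cyc3 g h h' k S S' S'' p q p' q' :
    rotation g S -> rotation h S' -> S :&: S' = [set p; q] ->
    g p = q -> h p = q -> #|S| = 4 -> #|S'| = 4 ->
    h' = h \/ h' = h^-1 -> rotation k S'' -> S' :&: S'' = [set p'; q'] ->
    h' p' = q' -> k p' = q' -> 2 < #|S''| -> k q' \notin S :|: S' ->
  exists2 i, i < 4 & exists x y z, uniq [:: x; y; z] /\
    [~ [~ g^-1, h^-1] ^ (g^-1 * h ^+ i), [~ h', k]] = cyc3 x y z.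
Proof.
move=> gS hS SS' gp hp S4 S'4 hh' kS S'S'' hp' kp' S''3 uN.
have /setIP[pS pS'] : p \in S :&: S' by rewrite SS' !inE eqxx.
have /setIP[p'S' p'S''] : p' \in S' :&: S'' by rewrite S'S'' !inE eqxx.
have /setIP[q'S' q'S''] : q' \in S' :&: S'' by rewrite S'S'' !inE eqxx orbT.
have common x : x \in S -> x \in S' -> (x == p) || (x == q).
  by move=> xS xS'; have := in_setI x S S'; rewrite xS xS' SS' !inE.
have h'S : rotation h' S' by case: hh' => ->; last exact: rotationV.
have Ms : moved [~ h', k] =i [:: p'; q'; h' q'; k q'].
  by apply: moved_edge_commg h'S kS S'S'' _ _ _ _; rewrite // S'4.
have Mt' : moved [~ g^-1, h^-1] =i [:: q; p; g^-1 p; h^-1 p].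
  apply: moved_edge_commg (rotationV gS) (rotationV hS) _ _ _ _ _.
  - by rewrite SS' setUC.
  - by rewrite -gp permK.
  - by rewrite -hp permK.
  - by rewrite S4.
  - by rewrite S'4.
set z := g^-1 p in Mt'; set y := h^-1 p in Mt'.
have zS : z \in S by rewrite /z -gS.1 moved_stableV // gS.1.
have yS' : y \in S' by rewrite /y -hS.1 moved_stableV // hS.1.
have gz : g z = p by rewrite permKV.
have hy : h y = p by rewrite permKV.
have [] := rotation_traject gS zS; rewrite S4 /= gz gp => U1 _.
have [] := rotation_traject hS yS'; rewrite S'4 /= hy hp => U2 ES'.
have qS : q \in S by rewrite -gp -gS.1 moved_perm gS.1.
have qS' : q \in S' by rewrite -hp -hS.1 moved_perm hS.1.
have gqS : g q \in S by rewrite -gS.1 moved_perm gS.1.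
have hqS : h q \in S' by rewrite -hS.1 moved_perm hS.1.
move: U1 U2; rewrite /= !inE !negb_or !andbT.
case/and3P=> /and3P[zp zq zgq] /andP[pq pgq] qgq.
case/and3P=> /and3P[yp yq yhq] /andP[_ phq] qhq.
have yS : y \notin S.
  by apply/negP=> /common/(_ yS'); rewrite (negPf yp) (negPf yq).
have hqNS : h q \notin S.
  by apply/negP=> /common/(_ hqS); rewrite ![h q == _]eq_sym (negPf phq) (negPf qhq).
have neqS a b : a \in S -> b \notin S -> a != b by move=> aS; apply: contra => /eqP<-.
(* Since S has four points, [g^-1 z] is [g q], and the support of [t1] is p, z, [g q] and y. Inside
   S' it therefore fixes exactly the consecutive pair q, [h q]. *)
pose t1 := [~ g^-1, h^-1] ^ g^-1.
have Mt1 x : (x \in moved t1) = (g x \in [:: q; p; z; y]).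
  by rewrite -Mt' -{1}(permK g x) movedJ.
have t1S' x : x \in S' -> (x \in moved t1) = (x \notin [:: q; h q]).
  rewrite ES' Mt1 !inE; case/or4P=> /eqP->.
  - rewrite (movedN (_ : y \notin moved g)) ?gS.1 // eqxx !orbT.
    by rewrite (negPf yq) (negPf yhq).
  - by rewrite gp eqxx (negPf pq) (negPf phq).
  - rewrite ![g q == _]eq_sym (negPf qgq) (negPf pgq) (negPf zgq) eqxx /= eq_sym.
    by rewrite (negPf (neqS _ _ _ _)).
  rewrite (movedN (_ : h q \notin moved g)) ?gS.1 // eqxx orbT.
  by rewrite ![h q == _]eq_sym (negPf qhq) (negPf phq) (negPf yhq) (negPf (neqS _ _ _ _)).
have t1SS' : moved t1 \subset S :|: S'.
  apply/subsetP=> x; rewrite Mt1 in_setU -gS.1 -moved_perm gS.1 !inE.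
  case/or4P=> /eqP E; rewrite ?E ?qS ?pS ?zS //.
  have xy : x = y; last by rewrite xy yS' orbT.
  by apply: (@perm_inj _ g); rewrite E movedN // gS.1.
(* A power of [h] carries the fixed pair onto the pair shared with S''. If [h'] is the inverse of
   [h], the pair is traversed backwards, so q goes to q' instead of p'. *)
have [i i4 Ei] : exists2 i, i < 4 & [:: p'; q'] =i [:: (h ^+ i) q; (h ^+ i) (h q)].
  case: hh' => Eh'; move: hp'; rewrite Eh' => hp'.
    have [i i4 E] := rotation_pow hS qS' p'S'; exists i; rewrite -?S'4 // => x.
    by rewrite -permM -expgS expgSr permM -E hp'.
  have [i i4 E] := rotation_pow hS qS' q'S'; exists i; rewrite -?S'4 // => x.
  by rewrite -permM -expgS expgSr permM -E -hp' permKV !inE orbC.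
exists i => //; rewrite conjgM -/t1.
have Mt x : ((h ^+ i) x \in moved (t1 ^ (h ^+ i))) = (x \in moved t1) by exact: movedJ.
have hiS' x : ((h ^+ i) x \in S') = (x \in S').
  by rewrite -hS.1; elim: (i) => [|j IH]; rewrite ?expg0 ?perm1 // expgSr permM moved_perm.
have tS' x : x \in S' -> (x \in moved (t1 ^ (h ^+ i))) = (x \notin [:: p'; q']).
  rewrite -[x](permKV (h ^+ i)) hiS' => /t1S'; rewrite Mt => ->.
  by rewrite Ei !inE !(inj_eq (@perm_inj _ _)).
have tu : k q' \notin moved (t1 ^ (h ^+ i)).
  have hu : k q' \notin moved (h ^+ i).
    have uS' : k q' \notin S' by apply: contra uN; rewrite in_setU orbC => ->.
    rewrite inE negbK; elim: (i) => [|j IH]; first by rewrite expg0 perm1.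
    by rewrite expgSr permM (eqP IH) movedN // hS.1.
  by rewrite -[k q'](movedN hu) Mt; apply: contra uN; apply: subsetP.
have h'q'S : h' q' \in S' by rewrite -h'S.1 moved_perm h'S.1.
have := rotation_uniq h'S p'S' (_ : 3 <= #|S'|); rewrite S'4 => /(_ isT).
rewrite /= hp' !inE !negb_or !andbT => /andP[/andP[_ p'q'] q'q'].
(* Of the four points moved by [[~ h', k]], the conjugate of [t1] fixes p' and q' by the choice of
   i, and [k q'] because it lies outside both 4-cycles. Only [h' q'] remains. *)
exists (h' q'); eexists; eexists; apply: commg_cyc3 => x; rewrite Ms.
apply/andP/eqP=> [[xt]|->]; last first.
  by rewrite tS' // !inE !negb_or ![h' q' == _]eq_sym p'q' q'q' eqxx !orbT.
rewrite !inE; case/or4P=> /eqP E; move: xt; rewrite E //.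
- by rewrite tS' // !inE eqxx.
- by rewrite tS' // !inE eqxx orbT.
- by rewrite (negPf tu).
Qed.

End Rotations.

(** * Sets all of whose 3-cycles lie in a group, and their maximal members *)

Section FullSets.
Local Open Scope group_scope.
Variables (T : finType) (H : {group {perm T}}).
Implicit Types (g : {perm T}) (x y z a v w : T) (S : {set T}).

Definition full3 S : bool :=
  [forall x in S, forall y in S, forall z in S,
     uniq [:: x; y; z] ==> (cyc3 x y z \in H)].

Lemma full3P S :
  reflect {in S & S & S, forall x y z, uniq [:: x; y; z] -> cyc3 x y z \in H}
          (full3 S).
Proof.
apply: (iffP forall_inP) => [fS x y z xS yS zS U | fS x xS].
  have/forall_inP/(_ y yS)/forall_inP/(_ z zS) := fS x xS.
  by move/implyP; apply.
apply/forall_inP=> y yS; apply/forall_inP=> z zS; apply/implyP; exact: fS.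
Qed.

Lemma ex_third S a b : 2 < #|S| -> exists2 v, v \in S & (v != a) && (v != b).
Proof.
move=> S3; have /card_gt0P[v] : 0 < #|S :\: [set a; b]|.
  rewrite cardsD subn_gt0; apply: leq_ltn_trans (subset_leq_card (subsetIr _ _)) _.
  by apply: leq_trans S3; rewrite cards2; case: eqP.
by rewrite !inE negb_or => /andP[? ?]; exists v.
Qed.

(** Every ordering of the three points is a rotation of the given one or of its reverse, that is, it
    gives the same 3-cycle or its inverse. *)
Lemma full3_triple x y z : uniq [:: x; y; z] -> cyc3 x y z \in H ->
  full3 [set x; y; z].
Proof.
move=> U xyz; have U1 : uniq [:: y; z; x] by rewrite -(rot_uniq 1) in U.
have U2 : uniq [:: z; x; y] by rewrite -(rot_uniq 1) in U1.
have yzx : cyc3 y z x \in H by rewrite -cyc3_rot.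
have zxy : cyc3 z x y \in H by rewrite -cyc3_rot.
have xzy : cyc3 x z y \in H by rewrite -cyc3V groupV.
have yxz : cyc3 y x z \in H by rewrite -cyc3V groupV.
have zyx : cyc3 z y x \in H by rewrite -cyc3V groupV.
apply/full3P=> a b c; rewrite !inE -!orbA.
by move=> /or3P[]/eqP-> /or3P[]/eqP-> /or3P[]/eqP->;
  rewrite //= !inE ?eqxx ?orbT ?andbF.
Qed.

(** First a 3-cycle through w and two points of S is found. Conjugating it by 3-cycles of S then
    replaces these two points by any others. *)
Lemma full3_extend S a w v : full3 S -> 2 < #|S| -> a \in S -> w \notin S ->
  uniq [:: a; w; v] -> cyc3 a w v \in H -> full3 (w |: S).
Proof.
move=> /full3P fS S3 aS wS U awv.
have nw x : x \in S -> x != w by move=> xS; apply: contra wS => /eqP<-.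
have [b bS [ba P0]] : exists2 b, b \in S & b != a /\ cyc3 a b w \in H.
  have [vS|vS] := boolP (v \in S).
    exists v => //; split; last by rewrite -cyc3V groupV.
    by rewrite eq_sym; move: U; rewrite /= !inE negb_or => /andP[/andP[_ ->]].
  have [b bS /andP[ba _]] := ex_third a a S3.
  have [b' b'S /andP[b'a b'b]] := ex_third a b S3.
  have U' : uniq [:: a; b; b'].
    by rewrite /= !inE negb_or eq_sym ba eq_sym b'a eq_sym b'b.
  exists b => //; split=> //.
  (* With v outside S the two 3-cycles share only a, and their commutator is [cyc3 a w b]. *)
  have [|_] := @commg_cyc3 _ (cyc3 a b b') (cyc3 a w v) a; last first.
    rewrite !cyc3E // eqxx => E; rewrite -cyc3V groupV -E.
    by rewrite groupR // fS.
  move=> x; rewrite !inE !cyc3E //; have [->|xa] := eqVneq x a.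
    by rewrite ?eqxx ba eq_sym nw.
  apply/negbTE; rewrite negb_and.
  have [xS|xS] := boolP (x \in S); apply/orP; [right|left].
    have /negPf-> : x != w by exact: nw.
    have /negPf-> : x != v by apply: contra vS => /eqP<-.
    by rewrite eqxx.
  have /negPf-> : x != b by apply: contra xS => /eqP->.
  have /negPf-> : x != b' by apply: contra xS => /eqP->.
  by rewrite eqxx.
have Uw x y : x \in S -> y \in S -> x != y -> uniq [:: x; y; w].
  by move=> xS yS xy; rewrite /= !inE negb_or xy !nw.
have Psym x y : x \in S -> y \in S -> x != y -> cyc3 x y w \in H -> cyc3 y x w \in H.
  by move=> xS yS xy; rewrite cyc3_rot ?Uw // -cyc3V groupV.
(* Conjugation by [cyc3 y x z] turns [cyc3 y x w] into [cyc3 x z w]. *)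
have Pstep x y z : x \in S -> y \in S -> z \in S -> x != y -> x != z ->
    cyc3 x y w \in H -> cyc3 x z w \in H.
  move=> xS yS zS xy xz Pxy; have [->//|zy] := eqVneq z y.
  have U' : uniq [:: y; x; z].
    by rewrite /= !inE negb_or eq_sym xy eq_sym zy xz.
  have yxz : cyc3 y x z \in H by exact: fS.
  have := Psym _ _ xS yS xy Pxy; rewrite -(groupJr _ yxz) cyc3J !cyc3E // !eqxx.
  rewrite (negPf xy) eq_sym (negPf (nw _ yS)) eq_sym (negPf (nw _ xS)).
  by rewrite eq_sym (negPf (nw _ zS)).
have Pall x y : x \in S -> y \in S -> x != y -> cyc3 x y w \in H.
  move=> xS yS xy; have [xa|xa] := eqVneq x a.
    by rewrite xa; apply: (Pstep a b) => //; rewrite 1?eq_sym // -xa eq_sym.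
  apply: (Pstep x a) => //; apply: Psym => //; first by rewrite eq_sym.
  by apply: (Pstep a b) => //; rewrite eq_sym.
apply/full3P=> x y z.
move=> /setU1P[->|xS] /setU1P[->|yS] /setU1P[->|zS];
  rewrite /= !inE ?eqxx ?orbT ?andbF //= negb_or andbT => /andP[/andP[n1 n2] n3].
- by rewrite cyc3_rot ?Pall // /= !inE negb_or n1 n2 n3.
- rewrite cyc3_rot; last by rewrite /= !inE negb_or n1 n2 n3.
  rewrite cyc3_rot; last by rewrite /= !inE negb_or n3 eq_sym n1 eq_sym n2.
  by rewrite Pall // eq_sym.
- exact: Pall.
- by apply: fS; rewrite //= !inE negb_or n1 n2 n3.
Qed.

Lemma full3_imset S g : g \in H -> full3 S -> full3 (g @: S).
Proof.
move=> gH /full3P fS; apply/full3P=> a b c.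
move=> /imsetP[x xS ->] /imsetP[y yS ->] /imsetP[z zS ->] U.
rewrite -cyc3J groupJ // fS //.
by rewrite -(map_inj_uniq (@perm_inj _ g)); exact: U.
Qed.

(** Maximality is in cardinality, not inclusion, so images under elements of the group inherit it.
    More than two points means more than two interconnected cycles can share. *)
Definition max_full3 S : Prop :=
  [/\ full3 S, 2 < #|S| & forall S', full3 S' -> #|S'| <= #|S|].

Lemma max_full3_exists x y z : uniq [:: x; y; z] -> cyc3 x y z \in H ->
  exists S, max_full3 S.
Proof.
move=> U /(full3_triple U) f0.
have [S fS maxS] := @arg_maxnP _ [set x; y; z] full3 (fun S => #|S|) f0.
exists S; split=> //; apply: leq_trans (maxS _ f0).
move: U; rewrite /= !inE negb_or andbT => /andP[/andP[xy xz] yz].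
by rewrite -setUA cardsU1 cards2 !inE negb_or xy xz yz.
Qed.

Lemma max_full3_imset S g : g \in H -> max_full3 S -> max_full3 (g @: S).
Proof.
move=> gH [fS S3 maxS]; rewrite /max_full3 card_imset; last exact: perm_inj.
by split=> //; apply: full3_imset.
Qed.

(* Otherwise [g @: S] glues to [S], by [full3_extend]. *)
Lemma max_full3_block S g x : max_full3 S -> g \in H -> x \in S -> g x \in S ->
  g @: S = S.
Proof.
move=> [fS S3 maxS] gH xS gxS; apply/eqP; rewrite eqEcard.
rewrite card_imset ?leqnn ?andbT; last exact: perm_inj.
apply/subsetP=> w wgS; apply/negPn/negP=> wS.
have gS3 : 2 < #|g @: S| by rewrite card_imset //; exact: perm_inj.
have [v vgS /andP[vgx vw]] := ex_third (g x) w gS3.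
have gxw : g x != w by apply: contra wS => /eqP<-.
have U : uniq [:: g x; w; v].
  by rewrite /= !inE negb_or gxw eq_sym vgx eq_sym vw.
have /maxS : full3 (w |: S).
  apply: (full3_extend fS S3 gxS wS U).
  by have/full3P fgS := full3_imset gH fS; exact: fgS (imset_f g xS) wgS vgS U.
by rewrite cardsU1 wS ltnn.
Qed.

End FullSets.

(** * Even permutations as short products of 3-cycles *)

Section EvenPermutations.
Local Open Scope group_scope.
Variable T : finType.

(** Take a moved x and a third moved point z. The 3-cycle [cyc3 (g x) x z] brings [g x] back to x
    and acts only on moved points, so multiplying by it fixes x and frees no fixed point: one factor
    per moved point suffices. *)
Lemma even_prod_cyc3 n (g : {perm T}) : #|moved g| <= n -> g \in 'Alt_T ->
  exists s : seq {perm T},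
    [/\ size s <= n,
        forall t, t \in s -> exists x y z, uniq [:: x; y; z] /\ t = cyc3 x y z
      & g = \prod_(t <- s) t].
Proof.
elim: n g => [|n IH] g.
  rewrite leqn0 cards_eq0 => /eqP g1 _; exists [::]; rewrite big_nil; split=> //.
  by apply/permP=> x; rewrite perm1 movedN // g1 inE.
have [g1 _ _|[x xg]] := set_0Vmem (moved g).
  exists [::]; rewrite big_nil; split=> //.
  by apply/permP=> x; rewrite perm1 movedN // g1 inE.
move=> gn gA; have gx : g x != x by move: xg; rewrite inE.
have [z gz U] := even_perm_moved gA gx.
have U' : uniq [:: g x; x; z].
  by move: U; rewrite /= !inE !negb_or [g x == x]eq_sym !andbT => /andP[/andP[-> ->] ->].
pose t := cyc3 (g x) x z.
have sub : moved (g * t) \subset moved g :\ x.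
  apply/subsetP=> w; rewrite !inE permM => gtw.
  have -> /= : w != x by apply: contra gtw => /eqP->; rewrite cyc3E // eqxx.
  apply: contra gtw => /eqP gw; rewrite gw cyc3E //.
  have /negPf-> : w != g x.
    by apply: contra gx => /eqP E; rewrite -(inj_eq (@perm_inj _ g)) -E gw.
  have /negPf-> : w != x by apply: contra gx => /eqP<-; rewrite gw.
  have /negPf-> : w != z by apply: contra gz => /eqP<-; rewrite gw.
  by rewrite eqxx.
have lt : #|moved (g * t)| < #|moved g|.
  by apply: leq_ltn_trans (subset_leq_card sub) _; rewrite [X in _ < X](cardsD1 x) xg.
have [||s [ss s3 Es]] := IH (g * t).
- by rewrite -ltnS (leq_trans lt).
- by move: gA; rewrite !Alt_even odd_permM odd_cyc3 // addbF.
exists (rcons s t^-1); split.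
- by rewrite size_rcons.
- move=> r; rewrite mem_rcons inE => /orP[/eqP->|/s3//].
  exists (g x), z, x; rewrite cyc3V; split=> //.
  by move: U'; rewrite /= !inE !negb_or [x == z]eq_sym !andbT => /andP[/andP[-> ->] ->].
- by rewrite big_rcons /= -Es -mulgA mulgV mulg1.
Qed.

Lemma ex_perm3 (a b c x y z : T) : uniq [:: a; b; c] -> uniq [:: x; y; z] ->
  exists s : {perm T}, [/\ s a = x, s b = y & s c = z].
Proof.
rewrite /= !inE !negb_or !andbT => /andP[/andP[ab ac] bc] /andP[/andP[xy xz] yz].
pose s1 := tperm a x; pose s2 := s1 * tperm (s1 b) y.
have s1a : s1 a = x by rewrite tpermL.
have s2a : s2 a = x.
  rewrite permM s1a tpermD // eq_sym //.
  by rewrite -[x in x == _]s1a (inj_eq (@perm_inj _ _)).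
have s2b : s2 b = y by rewrite permM tpermL.
exists (s2 * tperm (s2 c) z); split; rewrite permM ?s2a ?s2b ?tpermL //.
  rewrite tpermD // 1?eq_sym //.
  by rewrite -[x in x == _]s2a (inj_eq (@perm_inj _ _)).
rewrite tpermD // 1?eq_sym //.
by rewrite -[y in y == _]s2b (inj_eq (@perm_inj _ _)).
Qed.

End EvenPermutations.

(** * The permutation attached to a cycle: orbits, parity and shared vertices *)

Section CyclePermutations.
Local Open Scope group_scope.
Variable T : finType.
Implicit Types (c d : seq T) (b : bool) (x y p q : T).

Lemma cycle_permE c x : uniq c -> cycle_perm c x = next c x.
Proof.
rewrite /cycle_perm; case: (uniq c =P true) => [U _|nU U]; last by case: nU.
by rewrite permE.
Qed.

Lemma porbit_cycle_perm c x : uniq c -> x \in c ->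
  porbit (cycle_perm c) x = [set:: c].
Proof.
move=> U xc; apply/setP=> y; rewrite inE -(fconnect_cycle (cycle_next U) xc).
have E i : (cycle_perm c ^+ i) x = iter i (next c) x.
  by rewrite permX; apply: eq_iter => z; apply: cycle_permE.
apply/porbitP/idP=> [[i ->]|/iter_findex<-]; first by rewrite E fconnect_iter.
by exists (findex (next c) x y); rewrite E.
Qed.

Lemma card_seqset c : uniq c -> #|[set:: c]| = size c.
Proof. by move=> U; rewrite cardsE; apply/card_uniqP. Qed.

Lemma rotation_shift c b : uniq c -> 1 < size c -> rotation (shift (c, b)) [set:: c].
Proof.
move=> U c2; suff R : rotation (cycle_perm c) [set:: c].
  by case: b; rewrite /shift /=; last exact: rotationV.
split=> [|x]; last by rewrite inE; exact: porbit_cycle_perm.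
apply/setP=> x; rewrite !inE.
have [xc|xc] := boolP (x \in c); last first.
  by rewrite cycle_permE // next_nth (negPf xc) eqxx.
(* The first [size c] iterates of x are distinct, while a fixed x would already be repeated at the
   second one. *)
apply/negP=> /eqP fx; have := uniq_traject_porbit (cycle_perm c) x.
rewrite porbit_cycle_perm // card_seqset //.
by case: (size c) c2 => [|[|m]] //= _; rewrite fx inE eqxx.
Qed.

(** The sign is read off the number of orbits: the cycle itself and one singleton for each vertex
    off it. *)
Lemma odd_cycle_perm c : uniq c -> 1 < size c ->
  odd_perm (cycle_perm c) = ~~ odd (size c).
Proof.
move=> U c2; have [E _] := rotation_shift true U c2.
have [x xc] : exists x, x \in c by case: (c) c2 => // x s; exists x; rewrite mem_head.
have Ep : porbits (cycle_perm c) = [set:: c] |: [set [set y] | y in ~: [set:: c]].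
  apply/setP=> X; apply/imsetP/setU1P=> [[y _ ->]|[->|/imsetP[y yc ->]]].
  - have [yc|yc] := boolP (y \in c); first by left; apply: porbit_cycle_perm.
    right; apply/imsetP; exists y; first by rewrite !inE.
    apply/setP=> z; rewrite inE; apply/porbitP/eqP=> [[i ->]|->]; last first.
      by exists 0; rewrite expg0 perm1.
    elim: i => [|i IH]; first by rewrite expg0 perm1.
    by rewrite expgSr permM IH movedN // E inE.
  - by exists x; rewrite // porbit_cycle_perm.
  exists y => //; apply/setP=> z; rewrite inE.
  apply/eqP/porbitP=> [->|[i ->]]; first by exists 0; rewrite expg0 perm1.
  elim: i => [|i IH]; first by rewrite expg0 perm1.
  by rewrite expgSr permM IH movedN // E -in_setC.
rewrite /odd_perm Ep cardsU1 card_imset; last exact: set1_inj.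
rewrite -(cardsC [set:: c]) card_seqset // oddD.
have -> : [set:: c] \notin [set [set y] | y in ~: [set:: c]].
  by apply/imsetP=> [[y _ /(congr1 (fun A : {set T} => #|A|))]];
    rewrite card_seqset // cards1 => c1; rewrite c1 in c2.
by rewrite oddD /=; case: (odd (size c)); case: (odd _).
Qed.

Lemma consecutive_shift c x y : uniq c -> consecutive c x y ->
  exists b, shift (c, b) x = y.
Proof.
move=> U /and3P[_ _ /orP[/eqP<-|/eqP<-]].
  by exists true; rewrite /shift /= cycle_permE.
by exists false; rewrite /shift /= -cycle_permE // permK.
Qed.

(** The two cycles may run along a shared edge in opposite directions; the signs [b] and [b'] are
    chosen so that both shifts send p to q. *)
Lemma properly_interconnected_cases c d : uniq c -> uniq d ->
    properly_interconnected c d ->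
  (exists p, [set:: c] :&: [set:: d] = [set p]) \/
  (exists p q b b', [/\ p != q, [set:: c] :&: [set:: d] = [set p; q],
     shift (c, b) p = q & shift (d, b') p = q]).
Proof.
move=> Uc Ud.
have E : [set x | (x \in c) && (x \in d)] = [set:: c] :&: [set:: d].
  by apply/setP=> x; rewrite !inE.
rewrite /properly_interconnected E => /orP[/cards1P[p ->]|]; first by left; exists p.
case/andP=> /cards2P[p [q [pq ES]]]; rewrite ES => /forall_inP/(_ p).
rewrite !inE eqxx => /(_ isT)/forall_inP/(_ q); rewrite !inE eqxx orbT pq.
case/(_ isT)/andP=> /(consecutive_shift Uc)[b gp] /(consecutive_shift Ud)[b' hp].
by right; exists p, q, b, b'.
Qed.

End CyclePermutations.

(** * Counting shifts *)

Section Words.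
Local Open Scope group_scope.
Variables (T : finType) (C : seq (seq T)).
Implicit Types (g h : {perm T}) (m n : nat).

Definition word m g : Prop :=
  exists s : seq (seq T * bool),
    [/\ size s <= m, all (fun p => p.1 \in C) s & g = \prod_(p <- s) shift p].

Lemma word_le m n g : m <= n -> word m g -> word n g.
Proof. by move=> mn [s [sm sC ->]]; exists s; split=> //; apply: leq_trans mn. Qed.

Lemma word1 : word 0 1.
Proof. by exists [::]; rewrite big_nil. Qed.

Lemma wordM m n g h : word m g -> word n h -> word (m + n)%N (g * h).
Proof.
move=> [s [sm sC ->]] [r [rn rC ->]]; exists (s ++ r).
by rewrite size_cat leq_add // all_cat sC rC big_cat.
Qed.

Lemma word_shift (c : seq T) b : c \in C -> word 1 (shift (c, b)).
Proof. by move=> cC; exists [:: (c, b)]; rewrite /= cC big_seq1. Qed.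

Lemma shiftV (c : seq T) b : (shift (c, b))^-1 = shift (c, ~~ b).
Proof. by case: b; rewrite /shift //= invgK. Qed.

Lemma wordV m g : word m g -> word m g^-1.
Proof.
case=> s [sm sC ->]; apply: word_le sm _.
elim: s sC => [_|[c b] s IH /= /andP[cC /IH sC]].
  by rewrite big_nil invg1; exact: word1.
by rewrite big_cons invMg shiftV -addn1; apply: wordM sC (word_shift _ cC).
Qed.

Lemma wordJ m n g h : word m g -> word n h -> word (n + (m + n))%N (g ^ h).
Proof. by move=> wg wh; apply: wordM (wordV wh) (wordM wg wh). Qed.

Lemma wordR m n g h : word m g -> word n h ->
  word (m + (n + (m + n)))%N [~ g, h].
Proof. by move=> wg wh; apply: wordM (wordV wg) (wordJ wg wh). Qed.

Lemma wordX m g i : word m g -> word (i * m)%N (g ^+ i).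
Proof.
move=> wg; elim: i => [|i IH]; first by rewrite expg0; exact: word1.
by rewrite expgS mulSn; apply: wordM.
Qed.

Lemma shift_config (c : seq T) b : c \in C -> shift (c, b) \in config_group C.
Proof.
move=> cC; rewrite /shift /= (fun_if (fun g => g \in config_group C)).
by rewrite groupV if_same mem_gen // inE map_f.
Qed.

Lemma word_config m g : word m g -> g \in config_group C.
Proof.
case=> s [_ sC ->]; elim: s sC => [_|[c b] s IH /= /andP[cC sC]].
  by rewrite big_nil group1.
by rewrite big_cons groupM ?IH ?shift_config.
Qed.

Lemma config_word g : g \in config_group C -> exists m, word m g.
Proof.
(* In a finite group, products of generators without inverses already give everything generated. *)
case/gen_prodgP=> n [r rC ->]; exists n.
rewrite -[n in word n _]card_ord -sum1_card; elim/big_ind2: _ => [|m1 g1 m2 g2|i _].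
- exact: word1.
- exact: wordM.
have:= rC i; rewrite inE => /mapP[c cC ->]; exact: word_shift true cC.
Qed.

Definition act3 g (t : T * T * T) : T * T * T := (g t.1.1, g t.1.2, g t.2).

Lemma act3M g h t : act3 (g * h) t = act3 h (act3 g t).
Proof. by rewrite /act3 !permM. Qed.

Definition shift3 : rel (T * T * T) :=
  [rel t t' | t' \in [seq act3 (shift (c, b)) t | c <- C, b <- [:: true; false]]].

Lemma shift3P t t' :
  reflect (exists c b, c \in C /\ t' = act3 (shift (c, b)) t) (shift3 t t').
Proof.
apply: (iffP allpairsP) => [[[c b] [/= cC _ ->]]|[c [b [cC ->]]]].
  by exists c, b.
by exists (c, b); split=> //=; rewrite !inE; case: b.
Qed.

(* A shortest path in the Schreier graph on triples has at most [#|T| ^ 3] edges. *)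
Lemma word_triple g t : g \in config_group C ->
  exists2 h, word (#|T| ^ 3)%N h & act3 h t = act3 g t.
Proof.
move=> /config_word[m [s [_ sC Eg]]].
have : connect shift3 t (act3 g t).
  rewrite {g m}Eg; elim: s t sC => [t _|[c b] s IH t /= /andP[cC sC]].
    by rewrite big_nil /act3 !perm1; case: t => [[]].
  rewrite big_cons act3M; apply: connect_trans (IH _ sC).
  by apply: connect1; apply/shift3P; exists c, b.
case/connectP=> p0 /shortenP[p path_p Up _] ->.
have : size p <= (#|T| ^ 3)%N.
  apply: ltnW; rewrite -[_.+1]/(size (t :: p)) -(card_uniqP Up).
  by apply: leq_trans (max_card _) _; rewrite !card_prod !expnS expn0 muln1 mulnA.
move=> size_p; suff [h wh <-] : exists2 h, word (size p) h & act3 h t = last t p.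
  by exists h => //; apply: word_le wh.
elim: p {p0 Up size_p} t path_p => [|t' p IH] t /=.
  by exists 1; [exact: word1 | rewrite /act3 !perm1; case: t => [[]]].
case/andP=> /shift3P[c [b [cC ->]]] /IH[h wh <-].
by exists (shift (c, b) * h); [exact: wordM (word_shift b cC) wh | rewrite act3M].
Qed.

(** A conjugate of a 3-cycle depends only on where the conjugator sends its three points, so the
    conjugator can be replaced by a word of length at most [#|T| ^ 3], used once with its
    inverse. *)
Lemma word_cyc3 m a b c x y z : 'Alt_T \subset config_group C ->
    uniq [:: a; b; c] -> word m (cyc3 a b c) -> uniq [:: x; y; z] ->
  word (m + 2 * #|T| ^ 3)%N (cyc3 x y z).
Proof.
move=> AC Uabc wabc Uxyz.
have main g : g \in 'Alt_T -> word (m + 2 * #|T| ^ 3)%N (cyc3 (g a) (g b) (g c)).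
  move=> gA; have [h wh [<- <- <-]] := word_triple (a, b, c) (subsetP AC g gA).
  rewrite -cyc3J; apply: word_le (wordJ wabc wh).
  by rewrite mul2n -addnn addnCA.
have [g [ga gb gc]] := ex_perm3 Uabc Uxyz.
have [go|ge] := boolP (odd_perm g); last first.
  by have := main g; rewrite Alt_even ge ga gb gc => /(_ isT).
move: (Uabc); rewrite /= !inE !negb_or !andbT => /andP[/andP[ab ac] bc].
(* An odd [g] is made even by exchanging a and b first. This yields [cyc3 y x z], the inverse of the
   desired 3-cycle. *)
have := main (tperm a b * g); rewrite Alt_even odd_mul_tperm ab go => /(_ isT).
rewrite !permM tpermL tpermR tpermD // ga gb gc => /wordV.
by rewrite cyc3V -cyc3_rot.
Qed.

Lemma word_even m a b c g : 'Alt_T \subset config_group C ->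
    uniq [:: a; b; c] -> word m (cyc3 a b c) -> g \in 'Alt_T ->
  word (#|T| * (m + 2 * #|T| ^ 3))%N g.
Proof.
move=> AC Uabc wabc gA; have [s [sn s3 ->]] := even_prod_cyc3 (max_card _) gA.
apply: (@word_le (size s * (m + 2 * #|T| ^ 3))%N); first by rewrite leq_mul2r sn orbT.
elim: s {sn} s3 => [_|t s IH s3]; first by rewrite big_nil; exact: word1.
rewrite big_cons mulSn; apply: wordM; last first.
  by apply: IH => r rs; apply: s3; rewrite inE rs orbT.
have [x [y [z [U ->]]]] := s3 t (mem_head _ _).
exact: word_cyc3 Uabc wabc U.
Qed.

End Words.

Lemma word_sub (T : finType) (C C' : seq (seq T)) m g :
  {subset C' <= C} -> word C' m g -> word C m g.
Proof.
move=> sub [s [sm sC ->]]; exists s; split=> //.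
by apply: sub_all sC => p; exact: sub.
Qed.

(** * Connected families of cycles: reaching a 3-cycle and the alternating group *)

Section ConnectedCycles.
Local Open Scope group_scope.
Variables (T : finType) (D : seq (seq T)).
Implicit Types (c d e : seq T) (x y z p q : T).

Hypothesis D_cycle : forall c, c \in D -> uniq c /\ 2 < size c.
Hypothesis D_card : 1 < size (undup D).
Hypothesis D_connected : interconnection_connected D.
Hypothesis D_cover : forall x : T, exists2 c, c \in D & x \in c.

Let D_uniq c : c \in D -> uniq c. Proof. by case/D_cycle. Qed.
Let D_card_set c : c \in D -> #|[set:: c]| = size c.
Proof. by move/D_uniq/card_seqset. Qed.
Let D_rotation c b : c \in D -> rotation (shift (c, b)) [set:: c].
Proof. by case/D_cycle=> U /ltnW; exact: rotation_shift. Qed.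

Lemma interconnected_neighbour c : c \in D ->
  exists2 d, d \in D & properly_interconnected c d.
Proof.
move=> cD; have [d dD dc] : exists2 d, d \in D & d != c.
  have [d|all_c] := pickP (fun i : 'I_(size (undup D)) => nth [::] (undup D) i != c).
    by move=> dc; exists (nth [::] (undup D) d) => //; rewrite -mem_undup mem_nth.
  have := undup_uniq D; case: (undup D) D_card all_c => [|a [|b s]] //= _ all_c.
  have /= /negbFE/eqP-> := all_c ord0.
  have /= /negbFE/eqP-> := all_c (lift ord0 ord0).
  by rewrite inE eqxx.
have [[|e s] [/= sD sP ld]] := D_connected cD dD; first by rewrite ld eqxx in dc.
by case/andP: sD => eD _; case/andP: sP => ce _; exists e.
Qed.

Lemma card_interconnectedI c d : c \in D -> d \in D -> properly_interconnected c d ->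
  0 < #|[set:: c] :&: [set:: d]| <= 2.
Proof.
move=> /D_uniq Uc /D_uniq Ud /(properly_interconnected_cases Uc Ud).
case=> [[p ->]|[p [q [b [b' [_ -> _ _]]]]]]; first by rewrite cards1.
by rewrite cards2; case: eqP.
Qed.

(** The block property makes S swallow every cycle met along paths of the interconnection graph, and
    the cycles cover all vertices. *)
Lemma max_full3_setT (H : {group {perm T}}) S :
    {in D, forall c, cycle_perm c \in H} -> max_full3 H S -> S = setT.
Proof.
move=> DH.
(* The rotation along d fixes y, hence preserves the block S', which then contains the whole orbit
   of x. *)
have absorb S' d x y : max_full3 H S' -> d \in D -> x \in S' -> x \in d ->
    y \in S' -> y \notin d -> [set:: d] \subset S'.
  move=> maxS dD xS xd yS yd; have [E orbd] := D_rotation true dD.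
  have gy : cycle_perm d y = y by apply: movedN; rewrite E inE.
  have gS : cycle_perm d @: S' = S'.
    by apply: (max_full3_block maxS (DH _ dD) yS); rewrite gy.
  have xd' : x \in [set:: d] by rewrite inE.
  apply/subsetP=> z; rewrite -(orbd x xd') => /porbitP[i ->].
  elim: i => [|i IH]; first by rewrite expg0 perm1.
  by rewrite expgSr permM -gS imset_f.
have diff (A B : {set T}) : #|A :&: B| <= 2 -> 2 < #|A| ->
    exists2 x, x \in A & x \notin B.
  move=> AB A3; have /card_gt0P[x] : 0 < #|A :\: B|.
    by rewrite cardsD subn_gt0 (leq_ltn_trans AB).
  by rewrite in_setD => /andP[]; exists x.
(* Some point of S' is missing from c or from d, so that cycle is absorbed. It has a third vertex
   off the other cycle, which is then absorbed too. *)
have step S' c d x : max_full3 H S' -> c \in D -> d \in D ->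
    properly_interconnected c d -> x \in S' -> x \in c -> x \in d ->
  [set:: c] \subset S' /\ [set:: d] \subset S'.
  move=> maxS cD dD cd xS xc xd; have [_ S3 _] := maxS.
  have [_ le2] := andP (card_interconnectedI cD dD cd).
  have [_ c3] := D_cycle cD; have [_ d3] := D_cycle dD.
  rewrite -D_card_set // in c3; rewrite -D_card_set // in d3.
  have [y yS] := diff S' _ (leq_trans (subset_leq_card (subsetIr _ _)) le2) S3.
  rewrite in_setI negb_and !inE => /orP[yc|yd].
    have cS := absorb _ _ _ _ maxS cD xS xc yS yc; split=> //.
    have [z zc zd] := diff _ _ le2 c3; rewrite inE in zd.
    exact: absorb maxS dD xS xd (subsetP cS _ zc) zd.
  have dS := absorb _ _ _ _ maxS dD xS xd yS yd; split=> //.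
  rewrite setIC in le2; have [z zd zc] := diff _ _ le2 d3; rewrite inE in zc.
  exact: absorb maxS cD xS xc (subsetP dS _ zd) zc.
have spread S' c x : max_full3 H S' -> c \in D -> x \in S' -> x \in c ->
    (exists2 d, d \in D & properly_interconnected c d && (x \in d)) -> S' = setT.
  move=> maxS cD xS xc [d dD /andP[cd xd]].
  have [cS _] := step _ _ _ _ maxS cD dD cd xS xc xd.
  apply/setP=> y; rewrite inE; have [e eD ye] := D_cover y.
  have [s [sD sP le]] := D_connected cD eD.
  suff: [set:: last c s] \subset S' by rewrite le => /subsetP; apply; rewrite inE.
  elim: s c cD cS {xc cd le} sD sP => //= f s IH c cD cS /andP[fD sD] /andP[cf sP].
  have [/card_gt0P[z zcf] _] := andP (card_interconnectedI cD fD cf).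
  move: zcf; rewrite !inE => /andP[zc zf]; apply: IH => //.
  by have [] // := step _ _ _ z maxS cD fD cf _ zc zf; apply: subsetP cS _ _; rewrite inE.
move=> maxS; have [_ S3 _] := maxS.
have [x xS] : exists x, x \in S by apply/card_gt0P; exact: ltn_trans S3.
have [c cD xc] := D_cover x; have [d dD cd] := interconnected_neighbour cD.
have [/card_gt0P[p pcd] _] := andP (card_interconnectedI cD dD cd).
move: pcd; rewrite !inE => /andP[pc pd].
(* S meets c, but perhaps not at a vertex shared with d. A power of the rotation along c moves S
   onto such a vertex, and the image of S has the same size as S. *)
have [||i _ Ep] := rotation_pow (D_rotation true cD) (x := x) (y := p).
- by rewrite inE.
- by rewrite inE.
have gH : shift (c, true) ^+ i \in H by rewrite groupX // /shift /= DH.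
have gST : (shift (c, true) ^+ i) @: S = setT.
  apply: (spread _ c p (max_full3_imset gH maxS) cD) => //.
    by rewrite Ep imset_f.
  by exists d; rewrite // cd.
apply/eqP; rewrite eqEcard subsetT -[in X in X <= _]gST card_imset ?leqnn //.
exact: perm_inj.
Qed.

Lemma alt_sub_config x y z : uniq [:: x; y; z] -> cyc3 x y z \in config_group D ->
  'Alt_T \subset config_group D.
Proof.
move=> U /(max_full3_exists U)[S maxS].
have ST : S = setT.
  apply: max_full3_setT maxS => c cD.
  exact: (shift_config (C := D) (c := c) true).
have [/full3P fS _ _] := maxS; apply/subsetP=> g gA.
have [s [_ s3 ->]] := even_prod_cyc3 (max_card _) gA.
elim: s s3 => [_|t s IH s3]; first by rewrite big_nil group1.
rewrite big_cons groupM //; last by apply: IH => r rs; apply: s3; rewrite inE rs orbT.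
have [a [b [c [U' ->]]]] := s3 t (mem_head _ _).
by apply: fS => //; rewrite ST inE.
Qed.

(** The constant 32 comes from three 4-cycles: a commutator of length 4 conjugated by a word of
    length at most 4 has length at most 12, and its commutator with another word of length 4 has
    length at most 2 * (12 + 4). *)
Definition has_word_cyc3 : Prop :=
  exists x y z, uniq [:: x; y; z] /\ word D 32 (cyc3 x y z).

Lemma word_cyc3_vertex c d p : c \in D -> d \in D ->
  [set:: c] :&: [set:: d] = [set p] -> has_word_cyc3.
Proof.
move=> cD dD cdp; have [Ec _] := D_rotation true cD; have [Ed _] := D_rotation true dD.
have [|U E] := @commg_cyc3 _ (shift (c, true)) (shift (d, true)) p.
  by move=> x; rewrite Ec Ed -in_setI cdp inE.
exists p; eexists; eexists; split; first exact: U.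
by rewrite -E; apply: word_le (wordR (word_shift _ cD) (word_shift _ dD)).
Qed.

Lemma word_cyc3_three c : c \in D -> size c = 3 -> has_word_cyc3.
Proof.
move=> cD c3; rewrite -D_card_set // in c3.
have [x [y [z [U E]]]] := rotation_cyc3 (D_rotation true cD) c3.
by exists x, y, z; split=> //; rewrite -E; apply: word_le (word_shift _ cD).
Qed.

Lemma word_cyc3_long c d : c \in D -> d \in D -> properly_interconnected c d ->
  4 < size c -> 3 < size d -> has_word_cyc3.
Proof.
move=> cD dD cd c5 d4; rewrite -!D_card_set // in c5 d4.
have [[p]|] := properly_interconnected_cases (D_uniq cD) (D_uniq dD) cd.
  exact: word_cyc3_vertex.
case=> p [q [b [b' [_ cdpq gp hp]]]].
have [x [y [z [U E]]]] :=
  edge_long_cyc3 (D_rotation b cD) (D_rotation b' dD) cdpq gp hp c5 d4.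
exists x, y, z; split=> //; rewrite -E.
have wg := word_shift b cD; have wh := word_shift b' dD.
exact: word_le (wordR (wordR wg wh) (wordJ (wordR (wordV wg) (wordV wh)) (wordV wg))).
Qed.

(** Besides the shared edge, the 4-cycle e has two vertices, one next to each end of that edge. The
    new vertex u is one of them, and reversing directions and exchanging the ends reduces to the
    case where u follows the edge. *)
Lemma word_cyc3_four c d e u : c \in D -> d \in D -> e \in D ->
    properly_interconnected c d -> properly_interconnected d e ->
    size c = 4 -> size d = 4 -> size e = 4 ->
    u \in e -> u \notin [set:: c] :|: [set:: d] -> has_word_cyc3.
Proof.
move=> cD dD eD cd de c4 d4 e4 ue uN.
rewrite -D_card_set // in c4; rewrite -D_card_set // in d4; rewrite -D_card_set // in e4.
have [[p]|] := properly_interconnected_cases (D_uniq cD) (D_uniq dD) cd.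
  exact: word_cyc3_vertex.
case=> p [q [b1 [b2 [_ cdpq gp hp]]]].
have [[r]|] := properly_interconnected_cases (D_uniq dD) (D_uniq eD) de.
  exact: word_cyc3_vertex.
case=> p' [q' [b3 [b4 [_ depq hp' kp']]]].
have signs b : shift (d, b) = shift (d, b2) \/ shift (d, b) = (shift (d, b2))^-1.
  by rewrite shiftV; case: b; case: (b2); [left|right|right|left].
have main b b' a a' : [set:: d] :&: [set:: e] = [set a; a'] -> shift (d, b) a = a' ->
    shift (e, b') a = a' -> shift (e, b') a' = u -> has_word_cyc3.
  move=> deaa ha ka Eu.
  have [||i i4 [x [y [z [U E]]]]] := edge_four_cyc3 (D_rotation b1 cD) (D_rotation b2 dD)
    cdpq gp hp c4 d4 (signs b) (D_rotation b' eD) deaa ha ka.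
  - by rewrite e4.
  - by rewrite Eu.
  exists x, y, z; split=> //; rewrite -E.
  have wg := word_shift b1 cD; have wh := word_shift b2 dD.
  have wt := wordJ (wordR (wordV wg) (wordV wh)) (wordM (wordV wg) (wordX i wh)).
  apply: word_le (wordR wt (wordR (word_shift b dD) (word_shift b' eD))).
  by case: i i4 {wt E} => [|[|[|[|]]]].
have R := D_rotation b4 eD; set k := shift (e, b4) in kp' R.
have p'e : p' \in [set:: e].
  by have /setIP[] : p' \in [set:: d] :&: [set:: e] by rewrite depq !inE eqxx.
have kq'e : k q' \in [set:: e] by rewrite -kp' -R.1 !moved_perm R.1.
have [_ Ee] := rotation_traject (rotationV R) kq'e.
have u_notd : u \notin [set:: d] by apply: contra uN; rewrite in_setU orbC => ->.
have /setIP[p'd _] : p' \in [set:: d] :&: [set:: e] by rewrite depq !inE eqxx.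
have /setIP[q'd _] : q' \in [set:: d] :&: [set:: e] by rewrite depq !inE eqxx orbT.
have : u \in [set:: e] by rewrite inE.
rewrite Ee e4 /= permK -kp' permK !inE => /or4P[]/eqP Eu.
- by apply: (main b3 b4 p' q') => //; rewrite -/k Eu kp'.
- by rewrite Eu kp' q'd in u_notd.
- by rewrite Eu p'd in u_notd.
apply: (main (~~ b3) (~~ b4) q' p').
- by rewrite setUC.
- by rewrite -hp' -shiftV permK.
- by rewrite -kp' -shiftV permK.
by rewrite -shiftV -/k Eu.
Qed.

(** Slide along the path: while the next cycle e stays inside the six vertices of c and d, the pair
    d, e covers the same six vertices and can replace c, d. *)
Lemma four_cycles_leave c d s :
    (forall f, f \in D -> size f = 4) ->
    {in D &, forall f f', properly_interconnected f f' ->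
       #|[set:: f] :&: [set:: f']| = 2} ->
    c \in D -> d \in D -> properly_interconnected c d ->
    all (mem D) s -> path (@properly_interconnected T) d s ->
    ~~ ([set:: last d s] \subset [set:: c] :|: [set:: d]) ->
  exists c' d' e, [/\ c' \in D, d' \in D & e \in D] /\
    [/\ properly_interconnected c' d', properly_interconnected d' e
      & ~~ ([set:: e] \subset [set:: c'] :|: [set:: d'])].
Proof.
move=> D4 D2; elim: s c d => [|e s IH] c d cD dD cd /=; first by rewrite subsetUr.
case/andP=> eD sD /andP[de sP] far.
have [e_sub|e_far] := boolP ([set:: e] \subset [set:: c] :|: [set:: d]); last first.
  by exists c, d, e.
apply: (IH d e) => //; suff -> : [set:: d] :|: [set:: e] = [set:: c] :|: [set:: d] by [].
apply/eqP; rewrite eqEcard subUset subsetUr e_sub !cardsU.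
by rewrite !D_card_set // !D4 // !D2.
Qed.

Lemma has_word_cyc3_of_card : 6 < #|T| -> has_word_cyc3.
Proof.
move=> T7.
(* Successive cases: a single common vertex, a cycle of length 3, a cycle of length at least 5, and
   finally only 4-cycles sharing edges. *)
have [/hasP[c cD /hasP[d dD /cards1P[p E]]]|no1] :=
    boolP (has (fun c => has (fun d => #|[set:: c] :&: [set:: d]| == 1%N) D) D).
  exact: word_cyc3_vertex cD dD E.
have D2 : {in D &, forall f f', properly_interconnected f f' ->
       #|[set:: f] :&: [set:: f']| = 2}.
  move=> f f' fD f'D ff'; have := card_interconnectedI fD f'D ff'.
  have : #|[set:: f] :&: [set:: f']| != 1%N.
    by apply: contra no1 => E; apply/hasP; exists f => //; apply/hasP; exists f'.
  by case: #|_| => [|[|[|]]].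
have [/hasP[c cD /eqP c3]|no3] := boolP (has (fun c => size c == 3) D).
  exact: word_cyc3_three c3.
have ge4 c : c \in D -> 3 < size c.
  move=> cD; have [_ c3] := D_cycle cD; rewrite ltn_neqAle c3 eq_sym andbT.
  by apply: contra no3 => E; apply/hasP; exists c.
have [/hasP[c cD c5]|no5] := boolP (has (fun c => 4 < size c) D).
  have [d dD cd] := interconnected_neighbour cD.
  exact: word_cyc3_long cD dD cd c5 (ge4 d dD).
have D4 c : c \in D -> size c = 4.
  move=> cD; apply/eqP; rewrite eqn_leq ge4 // andbT leqNgt.
  by apply: contra no5 => E; apply/hasP; exists c.
have [c cD] : exists c, c \in D.
  by case: D D_card => // c s _; exists c; rewrite mem_head.
have [d dD cd] := interconnected_neighbour cD.
(* Two 4-cycles sharing an edge cover 4 + 4 - 2 = 6 vertices, so a seventh lies outside. *)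
have [x xN] : exists x, x \notin [set:: c] :|: [set:: d].
  have : 0 < #|~: ([set:: c] :|: [set:: d])|.
    rewrite cardsCs setCK subn_gt0; apply: leq_ltn_trans T7.
    by rewrite cardsU !D_card_set // !D4 // D2.
  by case/card_gt0P=> x; rewrite inE; exists x.
have [e eD xe] := D_cover x; have [s [sD sP le]] := D_connected dD eD.
have [|c' [d' [e' [[c'D d'D e'D] [c'd' d'e' /subsetPn[u]]]]]] :=
    four_cycles_leave D4 D2 cD dD cd sD sP.
  by rewrite le; apply/subsetPn; exists x => //; rewrite inE.
rewrite [u \in [set:: e']]inE => ue uN.
by apply: (word_cyc3_four c'D d'D e'D) ue uN => //; exact: D4.
Qed.

End ConnectedCycles.

(** * The configuration group and the number of shifts *)

Theorem theorem3 :
  exists K : nat,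
  forall (T : finType) (e : rel T) (C : seq (seq T)),
    simple_graph e ->
    6 < #|T| ->
    (forall c, c \in C -> is_cycle e c) ->
    induces_generalized_puzzle C ->
    (config_group C = (if all (fun c => odd (size c)) C then 'Alt_T else 'Sym_T)%g)
    /\ (forall g : {perm T}, g \in config_group C ->
          exists s : seq (seq T * bool),
            [/\ size s <= K * #|T| ^ 5,
                all (fun p => p.1 \in C) s
              & g = (\prod_(p <- s) shift p)%g]).
Proof.
(* The count below is 1 + 32 n + 2 n^4 with n the number of vertices, which 36 n^5 exceeds. *)
exists 36 => T e C _ T7 C_cycle [D [DC D2 D_conn D_cover]].
have C_uniq c : c \in C -> uniq c /\ 2 < size c by case/C_cycle.
have D_cycle c : c \in D -> uniq c /\ 2 < size c by move/DC/C_uniq.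
have [x [y [z [U w3]]]] := has_word_cyc3_of_card D_cycle D2 D_conn D_cover T7.
have sub_config : config_group D \subset config_group C.
  apply: genS; apply/subsetP=> g; rewrite !inE => /mapP[c cD ->].
  by rewrite map_f ?DC.
have AC : ('Alt_T)%g \subset config_group C.
  apply: subset_trans sub_config.
  exact: (alt_sub_config D_cycle D2 D_conn D_cover U (word_config w3)).
have odd_C c : c \in C -> odd_perm (cycle_perm c) = ~~ odd (size c).
  by case/C_uniq=> Uc c3; rewrite odd_cycle_perm // ltnW.
split=> [|g gC].
  case: ifPn => [/allP C_odd|/allPn[c cC c_even]].
    apply/eqP; rewrite eqEsubset AC andbT gen_subG; apply/subsetP=> g.
    rewrite inE => /mapP[c cC ->].
    by rewrite Alt_even odd_C // C_odd.
  apply/eqP; rewrite eqEsubset subsetT /=; apply/subsetP=> g _.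
  (* A cycle of even length gives an odd permutation; dividing an odd [g] by it lands in the
     alternating group. *)
  have [go|ge] := boolP (odd_perm g); last by apply: (subsetP AC); rewrite Alt_even.
  have cC' := shift_config true cC; rewrite /shift /= in cC'.
  rewrite -(mulgKV (cycle_perm c) g) groupM // (subsetP AC) //.
  by rewrite Alt_even odd_permM odd_permV odd_C // go c_even.
have bound : 1 + #|T| * (32 + 2 * #|T| ^ 3) <= 36 * #|T| ^ 5.
  have n1 : 0 < #|T| by exact: ltn_trans T7.
  have pow i : 0 < #|T| ^ i by rewrite expn_gt0 n1.
  have -> : #|T| ^ 5 = #|T| ^ 2 * #|T| ^ 3 by rewrite -expnD.
  have le_sq : #|T| <= #|T| ^ 2 by rewrite -{1}[#|T|]expn1 leq_exp2l // ltnW // (ltn_trans _ T7).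
  have := pow 2; have := pow 3; nia.
suff : word C (1 + #|T| * (32 + 2 * #|T| ^ 3)) g by exact: word_le bound.
have we := word_even AC U (word_sub DC w3).
have [go|ge] := boolP (odd_perm g); last first.
  by apply: word_le (leq_addl _ _) _; apply: we; rewrite Alt_even.
(* An odd element of the group forces a cycle of even length. One shift along it repairs the parity,
   which is the summand 1 in the bound. *)
have [c cC c_even] : exists2 c, c \in C & ~~ odd (size c).
  apply/allPn/negP=> /allP C_odd.
  suff /subsetP/(_ g gC) : config_group C \subset ('Alt_T)%g by rewrite Alt_even go.
  rewrite gen_subG; apply/subsetP=> h; rewrite inE => /mapP[c cC ->].
  by rewrite Alt_even odd_C // C_odd.
rewrite -(mulKVg (cycle_perm c) g).
apply: wordM (word_shift true cC) (we _ _).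
by rewrite Alt_even odd_permM odd_permV odd_C // go c_even.
Qed.
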